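(* Let $R$ be a finite ring with identity and $M$ a finite Frobenius $(R,R)$-bimodule. Let $n\in\mathbb{N}$, let $\mathcal{C}\subseteq M^n$ be a left $R$-submodule, and let $f:\mathcal{C}\longrightarrow M^n$ be an RT-isometry. Then there exists a matrix $A\in\mathrm{LT}_n(R)$ such that $f(v)=vA$ for all $v\in\mathcal{C}$, and thus $f$ extends to the RT-isometry $v\longmapsto vA$ on $M^n$.
   Context: For a finite ring $R$ with identity, the character group $\widehat{R}=\mathrm{Hom}((R,+),\mathbb{C}^* )$ is an $(R,R)$-bimodule via $(r\cdot\chi)(a)=\chi(ar)$ and $(\chi\cdot r)(a)=\chi(ra)$. A finite $(R,R)$-bimodule $M$ is called a Frobenius bimodule if ${}_RM\cong{}_R\widehat{R}$ as left $R$-modules and $M_R\cong\widehat{R}_R$ as right $R$-modules. Elements of $M^n$ are row vectors; for a matrix $A\in R^{n\times n}$ and $v\in M^n$, the product $vA\in M^n$ is defined in the usual way using the right $R$-module structure of $M$. $\mathrm{LT}_n(R)$ is the group of lower triangular matrices in $\mathrm{GL}_n(R)$. The Rosenbloom-Tsfasman weight (RT-weight) of $v=(v_1,\ldots,v_n)\in M^n$ is $\mathrm{wt}_{\mathrm{RT}}(v)=0$ if $v=0$ and $\mathrm{wt}_{\mathrm{RT}}(v)=\max\{i\mid v_i\neq0\}$ otherwise. An RT-isometry $f:\mathcal{C}\to M^n$ is an injective left $R$-linear map such that $\mathrm{wt}_{\mathrm{RT}}(f(v))=\mathrm{wt}_{\mathrm{RT}}(v)$ for all $v\in\mathcal{C}$.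 *)

(* Defs.v *)
From HB Require Import structures.
From mathcomp Require Import all_boot all_order all_algebra.
From mathcomp Require Import complex.
From mathcomp Require Import reals.
From mathcomp Require classical_sets cardinality.

Set Implicit Arguments.
Unset Strict Implicit.
Unset Printing Implicit Defensive.

Import Order.TTheory GRing.Theory Num.Theory.
Local Open Scope ring_scope.

HB.mixin Record Lmodule_isBimodule (R : pzRingType) V of GRing.Lmodule R V := {
  rscale : V -> R -> V;
  rscalerA : forall v (a b : R), rscale v (a * b) = rscale (rscale v a) b;
  rscaler1 : forall v, rscale v 1 = v;
  rscalerDl : forall (a : R) (v w : V),
    rscale (v + w) a = rscale v a + rscale w a;
  rscalerDr : forall v (a b : R), rscale v (a + b) = rscale v a + rscale v b;
  scale_rscaleA : forall (a b : R) (v : V),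
    rscale (a *: v) b = a *: rscale v b
}.

#[short(type="bimodType")]
HB.structure Definition Bimodule (R : pzRingType) :=
  {V of Lmodule_isBimodule R V & GRing.Lmodule R V}.

(* Here K is any model of the real numbers, so K[i] is the field of complex   *)
(* numbers. Being nonzero everywhere means taking values in C^*.              *)
Definition is_addchar (K : realType) (R : finPzRingType)
    (chi : {ffun R -> K[i]}) : bool :=
  [forall a, chi a != 0] && [forall a, forall b, chi (a + b) == chi a * chi b].

Record addchar (K : realType) (R : finPzRingType) := AddChar {
  addchar_val :> {ffun R -> K[i]};
  _ : is_addchar addchar_val
}.

HB.instance Definition _ (K : realType) (R : finPzRingType) :=
  [isSub for @addchar_val K R].
HB.instance Definition _ (K : realType) (R : finPzRingType) :=
  [Choice of addchar K R by <:].

Section AddCharBimodule.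
Variables (K : realType) (R : finPzRingType).
Implicit Types (chi psi : addchar K R) (r s a b : R).

Lemma addcharP (chi : {ffun R -> K[i]}) :
  reflect ((forall a, chi a != 0) /\
           (forall a b, chi (a + b) = chi a * chi b)) (is_addchar chi).
Proof.
apply: (iffP andP) => -[h1 h2]; split.
- exact/forallP.
- by move=> a b; have /forallP/(_ a)/forallP/(_ b)/eqP := h2.
- exact/forallP.
- by apply/forallP => a; apply/forallP => b; apply/eqP.
Qed.

Lemma addchar_neq0 chi a : chi a != 0.
Proof. by case: chi => c /= /addcharP[]. Qed.

Lemma addcharD chi a b : chi (a + b) = chi a * chi b.
Proof. by case: chi => c /= /addcharP[]. Qed.

Lemma addchar_ext chi psi : (forall a, chi a = psi a) -> chi = psi.
Proof. by move=> h; apply/val_inj/ffunP. Qed.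

Lemma addchar0 chi : chi 0 = 1.
Proof.
apply: (mulfI (addchar_neq0 chi 0)).
by rewrite -addcharD addr0 mulr1.
Qed.

Fact addchar_trivial_subproof : is_addchar ([ffun=> 1] : {ffun R -> K[i]}).
Proof.
by apply/addcharP; split=> [a|a b]; rewrite !ffunE ?oner_neq0 ?mulr1.
Qed.

Fact addchar_inv_subproof chi : is_addchar [ffun a => (chi a)^-1].
Proof.
apply/addcharP; split=> [a|a b]; rewrite !ffunE.
  by rewrite invr_eq0 addchar_neq0.
by rewrite addcharD invfM.
Qed.

Fact addchar_mul_subproof chi psi : is_addchar [ffun a => chi a * psi a].
Proof.
apply/addcharP; split=> [a|a b]; rewrite !ffunE.
  by rewrite mulf_neq0 ?addchar_neq0.
by rewrite !addcharD mulrACA.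
Qed.

Fact addchar_lact_subproof r chi : is_addchar [ffun a => chi (a * r)].
Proof.
apply/addcharP; split=> [a|a b]; rewrite !ffunE ?addchar_neq0 //.
by rewrite mulrDl addcharD.
Qed.

Fact addchar_ract_subproof chi r : is_addchar [ffun a => chi (r * a)].
Proof.
apply/addcharP; split=> [a|a b]; rewrite !ffunE ?addchar_neq0 //.
by rewrite mulrDr addcharD.
Qed.

Definition addchar_trivial : addchar K R := AddChar addchar_trivial_subproof.
Definition addchar_inv chi : addchar K R := AddChar (addchar_inv_subproof chi).
Definition addchar_mul chi psi : addchar K R :=
  AddChar (addchar_mul_subproof chi psi).
Definition addchar_lact r chi : addchar K R :=
  AddChar (addchar_lact_subproof r chi).
Definition addchar_ract chi r : addchar K R :=
  AddChar (addchar_ract_subproof chi r).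

Fact addchar_mulA : associative addchar_mul.
Proof. by move=> x y z; apply: addchar_ext => a; rewrite !ffunE mulrA. Qed.

Fact addchar_mulC : commutative addchar_mul.
Proof. by move=> x y; apply: addchar_ext => a; rewrite !ffunE mulrC. Qed.

Fact addchar_mul1 : left_id addchar_trivial addchar_mul.
Proof. by move=> x; apply: addchar_ext => a; rewrite !ffunE mul1r. Qed.

Fact addchar_mulV : left_inverse addchar_trivial addchar_inv addchar_mul.
Proof.
by move=> x; apply: addchar_ext => a; rewrite !ffunE mulVf ?addchar_neq0.
Qed.

(* The group of characters, with pointwise product, is written additively.    *)
HB.instance Definition _ := GRing.isZmodule.Build (addchar K R)
  addchar_mulA addchar_mulC addchar_mul1 addchar_mulV.

Fact addchar_lactA r s chi :
  addchar_lact r (addchar_lact s chi) = addchar_lact (r * s) chi.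
Proof. by apply: addchar_ext => a; rewrite !ffunE mulrA. Qed.

Fact addchar_lact1 : left_id 1 addchar_lact.
Proof. by move=> x; apply: addchar_ext => a; rewrite !ffunE mulr1. Qed.

Fact addchar_lactDr : right_distributive addchar_lact +%R.
Proof. by move=> r x y; apply: addchar_ext => a; rewrite !ffunE. Qed.

Fact addchar_lactDl chi : {morph addchar_lact^~ chi : r s / r + s}.
Proof.
by move=> r s; apply: addchar_ext => a; rewrite !ffunE mulrDr addcharD.
Qed.

HB.instance Definition _ := GRing.Zmodule_isLmodule.Build R (addchar K R)
  addchar_lactA addchar_lact1 addchar_lactDr addchar_lactDl.

Fact addchar_ractA chi r s :
  addchar_ract chi (r * s) = addchar_ract (addchar_ract chi r) s.
Proof. by apply: addchar_ext => a; rewrite !ffunE mulrA. Qed.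

Fact addchar_ract1 chi : addchar_ract chi 1 = chi.
Proof. by apply: addchar_ext => a; rewrite !ffunE mul1r. Qed.

Fact addchar_ractDl r chi psi :
  addchar_ract (chi + psi) r = addchar_ract chi r + addchar_ract psi r.
Proof. by apply: addchar_ext => a; rewrite !ffunE. Qed.

Fact addchar_ractDr chi r s :
  addchar_ract chi (r + s) = addchar_ract chi r + addchar_ract chi s.
Proof. by apply: addchar_ext => a; rewrite !ffunE mulrDl addcharD. Qed.

Fact addchar_lract r s chi :
  addchar_ract (r *: chi) s = r *: addchar_ract chi s.
Proof. by apply: addchar_ext => a; rewrite !ffunE mulrA. Qed.

HB.instance Definition _ := Lmodule_isBimodule.Build R (addchar K R)
  addchar_ractA addchar_ract1 addchar_ractDl addchar_ractDr addchar_lract.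

End AddCharBimodule.

Definition left_isomorphic (R : pzRingType) (V W : bimodType R) : Prop :=
  exists phi : {linear V -> W}, bijective phi.

Definition right_isomorphic (R : pzRingType) (V W : bimodType R) : Prop :=
  exists2 psi : {additive V -> W}, bijective psi &
    forall v (r : R), psi (rscale v r) = rscale (psi v) r.

Definition Frobenius_bimodule (K : realType) (R : finPzRingType)
    (M : bimodType R) : Prop :=
  [/\ cardinality.finite_set (@classical_sets.setT M),
      left_isomorphic M (addchar K R) &
      right_isomorphic M (addchar K R)].

(* Row vectors over M are elements of M ^ n, i.e. {ffun 'I_n -> M}, since     *)
(* 'rV[M]_n carries no left R-module structure. Indices start from 0.         *)
Definition row_mulmx (R : pzRingType) (M : bimodType R) (n : nat)
    (v : M ^ n) (A : 'M[R]_n) : M ^ n :=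
  [ffun j => \sum_(i < n) rscale (v i) (A i j)].

(* The ring R need not be commutative, so unitmx is not available.            *)
Definition in_GL (R : pzRingType) (n : nat) (A : 'M[R]_n) : Prop :=
  exists B : 'M[R]_n, A *m B = 1%:M /\ B *m A = 1%:M.

(* is_trig_mx A says that A i j = 0 whenever i < j.                           *)
Definition in_LT (R : pzRingType) (n : nat) (A : 'M[R]_n) : Prop :=
  is_trig_mx A /\ in_GL A.

(* The successor accounts for 0-based indices; an empty max is 0.             *)
Definition wtRT (V : nmodType) (n : nat) (v : V ^ n) : nat :=
  \max_(i < n | v i != 0) i.+1.

(* Only the restriction of f to C matters.                                    *)
Record RT_isometry (R : pzRingType) (M : lmodType R) (n : nat)
    (C : {pred M ^ n}) (f : M ^ n -> M ^ n) : Prop := {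
  RT_isometryD : {in C &, forall v w, f (v + w) = f v + f w};
  RT_isometryZ : forall r : R, {in C, forall v, f (r *: v) = r *: f v};
  RT_isometry_inj : {in C &, injective f};
  RT_isometry_wt : {in C, forall v, wtRT (f v) = wtRT v}
}.

(* Main.v *)
(* A left isomorphism of M with the character module yields a character eps   *)
(* of M nondegenerate on both sides. A left linear map g : C -> M is          *)
(* determined by the character eps \o g, and character sums show that g       *)
(* vanishing on the common kernel of maps h_i : C -> M has the form           *)
(* sum_i h_i(v) a_i. An RT-isometry maps the vectors v of C supported on      *)
(* [0, j] injectively through v_j to the j-th entry of the image, so there    *)
(* f(v)_j = v_j a and v_j = f(v)_j c; stable range 1 of the finite ring R     *)
(* turns a into a unit u. The difference f(v)_j - v_j u then only depends on  *)
(* the v_i with j < i, which gives the rest of column j of the matrix.        *)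
Require Import Defs.
From HB Require Import structures.
From mathcomp Require Import all_boot all_order all_algebra.
From mathcomp Require Import complex.
From mathcomp Require Import reals.
From mathcomp Require classical_sets cardinality.

Set Implicit Arguments.
Unset Strict Implicit.
Unset Printing Implicit Defensive.

Import Order.TTheory GRing.Theory Num.Theory.
Local Open Scope ring_scope.

(** The columns of the matrix can be found independently ([RT_isometry_column]). On the vectors of
    [C] whose entries beyond [j] vanish, preservation of the weight forces [v j] and [f v j] to
    vanish together, so [unit_correction] relates them by a unit, the diagonal entry. After
    subtracting its contribution, what remains of [f v j] vanishes whenever the entries beyond [j]
    do, and [hom_rscale] writes it as a combination of these entries, with coefficients below the
    diagonal. These two lemmas rest on a generating character of [M] and on stable range 1
    ([lift_unit_mod]). Conversely, a triangular matrix with unit diagonal is invertible and keeps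
    the position of the last nonzero entry, which gives the isometry on all of [M ^ n]. *)

(** Moebius inversion on the lattice of subsets: a superset count is the sum of the exact counts
    over all larger sets, so the exact counts follow by induction on the size of the complement of
    [L]. *)
Lemma card_fiber_eq (T U : finType) (F : T -> {set U}) (P Q : {set T}) :
    (forall L : {set U}, #|[set x in P | L \subset F x]|
             = #|[set x in Q | L \subset F x]|) ->
  forall L : {set U}, #|[set x in P | F x == L]| = #|[set x in Q | F x == L]|.
Proof.
move=> hPQ L.
have [k] := ubnP #|~: L|; elim: k L => // k IHk L /ltnSE leLk.
have split_card (S : {set T}) : #|[set x in S | L \subset F x]|
    = (#|[set x in S | F x == L]|
       + \sum_(L' : {set U} | L \proper L') #|[set x in S | F x == L']|)%N.
  rewrite -sum1_card (partition_big F (fun L' : {set U} => L \subset L')) => [|x]; last first.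
    by rewrite inE => /andP[].
  rewrite (bigD1 L) //=; congr (_ + _)%N.
    rewrite -sum1_card; apply: eq_bigl => x; rewrite !inE.
    by case: eqP => [->|]; rewrite ?subxx ?andbT ?andbF.
  apply: eq_big => [L'|L' /andP[sLL' _]].
    by rewrite properEneq eq_sym andbC.
  rewrite -sum1_card; apply: eq_bigl => x; rewrite !inE.
  by case: eqP => [->|]; rewrite ?sLL' ?andbT ?andbF.
have := hPQ L; rewrite !split_card.
rewrite (eq_bigr (fun L' : {set U} => #|[set x in Q | F x == L']|)) => [/addIn //|L' ltLL'].
apply: IHk; apply: leq_trans leLk; apply: proper_card.
by rewrite properC.
Qed.

(** * Stable range 1 for finite rings *)

Section StableRange.
Variables (R : finPzRingType) (J : {set R}).
Hypotheses (J0 : 0 \in J) (JB : {in J &, forall x y, x - y \in J}).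
Hypothesis (JM : forall x r : R, x \in J -> x * r \in J).

Let JN x : x \in J -> - x \in J.
Proof. by move=> Jx; rewrite -sub0r JB. Qed.

Let JD : {in J &, forall x y, x + y \in J}.
Proof. by move=> x y Jx Jy; rewrite -[y]opprK JB ?JN. Qed.

Lemma left_mul_inj_unit (u : R) :
  (forall x, u * x = 0 -> x = 0) -> exists w, u * w = 1 /\ w * u = 1.
Proof.
move=> u_reg.
have u_inj : injective ( *%R u).
  move=> x y /= /eqP; rewrite -subr_eq0 -mulrBr => /eqP/u_reg/eqP.
  by rewrite subr_eq0 => /eqP.
have [w uK wK] := injF_bij u_inj.
exists (w 1); split; first exact: wK.
by apply: u_inj; rewrite mulrA wK mul1r mulr1.
Qed.

Let ann (x : R) : {set R} := [set r | x * r == 0].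

Section Fibers.
Variables (a c : R) (ac : 1 - a * c \in J) (L : {set R}).

Let S := [set x | L \subset ann x].

Let SP (x : R) : reflect (forall l, l \in L -> x * l = 0) (x \in S).
Proof.
rewrite inE; apply: (iffP subsetP) => h l /h; rewrite ?inE => /eqP //.
Qed.

Let SD : {in S &, forall x y, x + y \in S}.
Proof.
by move=> x y /SP hx /SP hy; apply/SP => l Ll; rewrite mulrDl hx ?hy ?addr0.
Qed.

Let SN : {in S, forall x, - x \in S}.
Proof. by move=> x /SP hx; apply/SP => l Ll; rewrite mulNr hx ?oppr0. Qed.

Let SM (r : R) : {in S, forall x : R, r * x \in S}.
Proof. by move=> x /SP hx; apply/SP => l Ll; rewrite -mulrA hx ?mulr0. Qed.

Let inS (P : pred R) x : (x \in [set y in S | P y]) = (x \in S) && P x.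
Proof. by rewrite in_set. Qed.

Let card_coset (b n x0 : R) : x0 \in S -> b * x0 - n \in J ->
  #|[set x in S | b * x - n \in J]| = #|[set x in S | b * x \in J]|.
Proof.
move=> Sx0 Jx0; rewrite -[RHS](card_imset _ (addrI x0)); congr #|pred_of_set _|.
apply/setP => x; rewrite inS; apply/idP/imsetP => [/andP[Sx Jx]|[y]].
  exists (x - x0); rewrite ?inS; last by rewrite addrC subrK.
  have -> : x - x0 \in S by rewrite SD ?SN.
  have -> : b * (x - x0) = (b * x - n) - (b * x0 - n).
    by rewrite opprB addrA subrK mulrBr.
  exact: JB.
rewrite inS => /andP[Sy Jy] ->; rewrite SD //= mulrDr addrAC; exact: JD.
Qed.

Let card_ker : #|[set x in S | 1 * x \in J]| = #|[set x in S | a * x \in J]|.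
Proof.
(* Both sides count the pairs (x, y) of S * S with a x - y in J, up to the    *)
(* factor #|S|.                                                               *)
have S_gt0 : (0 < #|S|)%N.
  by apply/card_gt0P; exists 0; apply/SP => l _; rewrite mul0r.
apply/eqP; rewrite -(eqn_pmul2l S_gt0) -!sum_nat_const; apply/eqP.
transitivity (\sum_(x in S) \sum_(y in S | (1 * y - a * x)%R \in J) 1)%N.
  apply: eq_bigr => x Sx; rewrite -(@card_coset 1 (a * x) (a * x)) ?SM //.
    by rewrite -sum1_card; apply: eq_bigl => y; rewrite inS.
  by rewrite mul1r subrr.
rewrite (exchange_big_dep (mem S)) => [|x y _ /andP[]//].
apply: eq_bigr => y Sy; rewrite -(@card_coset a y (c * y)) ?SM //.
  rewrite -sum1_card; apply: eq_bigl => x; rewrite inS mul1r.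
  have -> /= : y \in S = true by [].
  by congr andb; apply/idP/idP => /JN; rewrite opprB.
by rewrite mulrA -[X in _ - X]mul1r -mulrBl -opprB mulNr JN ?JM.
Qed.

(** The set [S] of elements killing [L] is a left ideal. If [x0] in [S] solves [x = n] modulo [J],
    then [c * x0] solves [a * x = n]; if [x] solves the latter, [a * x] solves the former. So both
    sets are empty or are cosets of kernels of equal size ([card_ker]). *)
Lemma card_annihilating_fiber n :
  #|[set x in [set x | x - n \in J] | L \subset ann x]|
    = #|[set x in [set x | a * x - n \in J] | L \subset ann x]|.
Proof.
have toS b : #|[set x in [set x | b * x - n \in J] | L \subset ann x]|
    = #|[set x in S | b * x - n \in J]|.
  by apply: eq_card => x; rewrite !inE andbC.
transitivity #|[set x in [set x | 1 * x - n \in J] | L \subset ann x]|.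
  by apply: eq_card => x; rewrite !inE mul1r.
rewrite !toS.
have [x0 /andP[Sx0]|h0] := pickP [pred x in S | 1 * x - n \in J].
  rewrite mul1r => Jx0; rewrite (@card_coset 1 n x0) ?mul1r // card_ker.
  rewrite (@card_coset a n (c * x0)) ?SM // mulrA.
  have -> : a * c * x0 - n = (x0 - n) - (1 - a * c) * x0.
    by rewrite mulrBl mul1r opprB addrAC [x0 + _]addrC subrK.
  by rewrite JB ?JM.
rewrite !eq_card0 // => x; rewrite inE.
  by apply/negP => /andP[Sx Jx]; have /negP[] := h0 (a * x); rewrite inE SM ?mul1r.
by have := h0 x; rewrite /=.
Qed.

End Fibers.

(* Finite rings have stable range 1. The solutions x of "x = a mod J" and of  *)
(* "a x = a mod J" are equidistributed with respect to their annihilators, as *)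
(* in Lovasz's cancellation argument, and x = 1 solves the latter.            *)
Lemma lift_unit_mod (a c : R) : 1 - a * c \in J ->
  exists u w, [/\ u * w = 1, w * u = 1 & u - a \in J].
Proof.
move=> ac.
have /card_gt0P[u] :
    (0 < #|[set x in [set x | (x - a)%R \in J] | ann x == ann 1%R]|)%N.
  rewrite (card_fiber_eq (fun L => card_annihilating_fiber ac L a)).
  by apply/card_gt0P; exists 1; rewrite !inE mulr1 subrr J0 eqxx.
rewrite !inE => /andP[Ju /eqP/setP annu].
have [|w [uw wu]] := @left_mul_inj_unit u; last by exists u, w.
by move=> x /eqP ux0; have := annu x; rewrite !inE ux0 mul1r => /esym/eqP.
Qed.

End StableRange.

(** * Orthogonality of characters on finite groups given as lists *)

Section CharacterSums.
Variable F : numDomainType.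

(** Translation by [w] permutes [s], so the sum equals [chi w] times itself. *)
Lemma sum_character_eq0 (V : zmodType) (s : seq V) (chi : V -> F) (w : V) :
    uniq s -> {in s &, forall x y, x + y \in s} ->
    {in s &, forall x y, chi (x + y) = chi x * chi y} ->
    w \in s -> chi w != 1 ->
  \sum_(v <- s) chi v = 0.
Proof.
move=> us sD chiD sw chiw.
have shift : perm_eq [seq w + v | v <- s] s.
  have us' : uniq [seq w + v | v <- s] by rewrite map_inj_uniq //; exact: addrI.
  apply: uniq_perm => //.
  have [] // := uniq_min_size us' (s2 := s) _ _; last by rewrite size_map.
  by move=> _ /mapP[v sv ->]; exact: sD.
have : \sum_(v <- s) chi v = chi w * \sum_(v <- s) chi v.
  rewrite -{1}(perm_big _ shift) /= big_map mulr_sumr.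
  by rewrite !big_seq; apply: eq_bigr => v sv; rewrite chiD.
move/eqP; rewrite -subr_eq0 -[X in X - _]mul1r -mulrBl mulf_eq0 subr_eq0.
by rewrite eq_sym (negPf chiw) => /eqP.
Qed.

Lemma sum_character (V : zmodType) (s : seq V) (chi : V -> F) :
    uniq s -> {in s &, forall x y, x + y \in s} ->
    {in s &, forall x y, chi (x + y) = chi x * chi y} ->
  \sum_(v <- s) chi v = (size s * all (fun v => chi v == 1) s)%:R.
Proof.
move=> us sD chiD; have [/allP h|/allPn[w sw chiw]] := boolP (all _ s).
  rewrite muln1 -sum1_size natr_sum !big_seq.
  by apply: eq_bigr => v /h/eqP.
by rewrite muln0 (@sum_character_eq0 _ _ _ w).
Qed.

(** The double sum of [beta] is evaluated in both orders by orthogonality. *)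
Lemma card_radicals (U V : zmodType) (s : seq U) (t : seq V)
    (beta : U -> V -> F) :
    uniq s -> uniq t -> (forall x, x \in s) -> (forall y, y \in t) ->
    (forall x x' y, beta (x + x') y = beta x y * beta x' y) ->
    (forall x y y', beta x (y + y') = beta x y * beta x y') ->
  (size s * count (fun y => all (fun x => beta x y == 1%R) s) t
   = size t * count (fun x => all (fun y => beta x y == 1%R) t) s)%N.
Proof.
move=> us ut hs ht bDl bDr; apply/eqP; rewrite -(eqr_nat F); apply/eqP.
have sum_count (T : Type) (r : seq T) (P : pred T) m :
    (m * count P r)%:R = \sum_(x <- r) (m * P x)%:R :> F.
  rewrite -natr_sum -big_distrr /=; congr (_ * _)%:R.
  by rewrite -sum1_count big_mkcond; apply: eq_bigr => x _; case: (P x).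
rewrite !sum_count.
transitivity (\sum_(y <- t) \sum_(x <- s) beta x y).
  by apply: eq_bigr => y _; rewrite sum_character // => x x' *; rewrite bDl.
rewrite exchange_big; apply: eq_bigr => x _.
by rewrite sum_character // => y y' *; rewrite bDr.
Qed.

End CharacterSums.

Section Rscale.
Variables (R : pzRingType) (M : bimodType R).
Implicit Types (v : M) (a : R).

Lemma rscale0r a : rscale (0 : M) a = 0.
Proof. by apply: (addrI (rscale (0 : M) a)); rewrite -rscalerDl !addr0. Qed.

Lemma rscaler0 v : rscale v 0 = 0.
Proof. by apply: (addrI (rscale v 0)); rewrite -rscalerDr !addr0. Qed.

Lemma rscalerN v a : rscale v (- a) = - rscale v a.
Proof. by apply: (addrI (rscale v a)); rewrite -rscalerDr !subrr rscaler0. Qed.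

Lemma rscalerB v a b : rscale v (a - b) = rscale v a - rscale v b.
Proof. by rewrite rscalerDr rscalerN. Qed.

End Rscale.

Definition linear_on (R : pzRingType) (V W : lmodType R) (S : {pred V})
    (h : V -> W) : Prop :=
  {in S &, {morph h : x y / x + y}} /\ forall r, {in S, {morph h : x / r *: x}}.

(** * Generating characters and maps given by right multiplication *)

Section GeneratingCharacter.
Variables (K : realType) (R : finPzRingType) (M : bimodType R).

Record generating_character (eps : M -> K[i]) : Prop := {
  gencharD : forall x y, eps (x + y) = eps x * eps y;
  genchar0 : eps 0 = 1;
  genchar_left : forall x, (forall r : R, eps (r *: x) = 1) -> x = 0;
  genchar_right : forall x, (forall r : R, eps (rscale x r) = 1) -> x = 0
}.

Lemma Frobenius_bimodule_enum : Frobenius_bimodule K M ->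
  exists2 t : seq M, uniq t & forall x, x \in t.
Proof.
case=> /cardinality.finite_seqP[t defT] _ _.
exists (undup t) => [|x]; first exact: undup_uniq.
rewrite mem_undup; have : classical_sets.setT x by [].
by rewrite defT.
Qed.

(* For phi : M -> R^ a left isomorphism, x |-> phi(x)(1) is a generating      *)
(* character. Its right nondegeneracy follows from comparing the cardinals of *)
(* the radicals of the pairings (r, x) |-> eps(r x) and (r, x) |-> eps(x r):  *)
(* those on the R side are both the common kernel of all characters of R.     *)
Lemma Frobenius_generating_character : Frobenius_bimodule K M ->
  exists eps : M -> K[i], generating_character eps.
Proof.
move=> hM; have [t ut ht] := Frobenius_bimodule_enum hM.
case: hM => _ [phi [phi' phiK phi'K]] [psi [psi' psiK psi'K] psir].
pose eps x := phi x 1.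
have epsE r x : eps (r *: x) = phi x r.
  by rewrite /eps linearZ /= ffunE mul1r.
have epsD x y : eps (x + y) = eps x * eps y by rewrite /eps raddfD ffunE.
have eps0 : eps 0 = 1 by rewrite /eps raddf0 ffunE.
have left_nd x : (forall r : R, eps (r *: x) = 1) -> x = 0.
  move=> h; apply: (can_inj phiK); rewrite raddf0; apply: addchar_ext => r.
  by rewrite -epsE h ffunE.
exists eps; split=> // x hx.
have sR : forall r : R, r \in enum R by move=> r; rewrite mem_enum.
have Z_eq : count (fun r => all (fun y => eps (rscale y r) == 1) t) (enum R)
        = count (fun r => all (fun y => eps (r *: y) == 1) t) (enum R).
  apply: eq_count => r; apply/allP/allP => h y _.
    (* Every character of [R] is [chi = psi (psi' chi)]. By the hypothesis on [r], left
       nondegeneracy kills [psi' chi] times [r], so [chi] acted on by [r] is trivial; its value at 1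
       is [chi r]. *)
    apply/eqP; rewrite epsE; set chi := phi y.
    have psi'r0 : rscale (psi' chi) r = 0.
      apply: left_nd => a; rewrite -scale_rscaleA.
      by apply/eqP/h.
    have := psir (psi' chi) r; rewrite psi'r0 raddf0 psi'K => /(congr1 val)/ffunP/(_ 1).
    by rewrite !ffunE mulr1.
  suff -> : rscale y r = 0 by rewrite eps0.
  apply: (can_inj psiK); rewrite raddf0 psir; apply: addchar_ext => b.
  rewrite !ffunE; have /eqP := h (phi' (b *: psi y)) (ht _).
  by rewrite epsE phi'K ffunE.
have rightE : (size (enum R) *
    count (fun y => all (fun r => eps (rscale y r) == 1%R) (enum R)) t
    = size t *
    count (fun r => all (fun y => eps (rscale y r) == 1%R) t) (enum R))%N.
  apply: (card_radicals (beta := fun r y => eps (rscale y r))) => //.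
  - exact: enum_uniq.
  - by move=> r s y; rewrite rscalerDr epsD.
  - by move=> r y z; rewrite rscalerDl epsD.
have leftE : (size (enum R) *
    count (fun y => all (fun r : R => eps (r *: y)%R == 1%R) (enum R)) t
    = size t *
    count (fun r : R => all (fun y => eps (r *: y)%R == 1%R) t) (enum R))%N.
  apply: (card_radicals (beta := fun (r : R) y => eps (r *: y))) => //.
  - exact: enum_uniq.
  - by move=> r s y; rewrite scalerDl epsD.
  - by move=> r y z; rewrite scalerDr epsD.
have R_gt0 : (0 < size (enum R))%N by rewrite -cardE; apply/card_gt0P; exists 0.
move/eqP: rightE; rewrite Z_eq -leftE eqn_pmul2l // => /eqP.
rewrite [RHS](eq_count (a2 := pred1 0)) => [|y]; last first.
  apply/allP/eqP => [h|-> r _]; last by rewrite scaler0 eps0.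
  by apply: left_nd => r; apply/eqP/h.
rewrite (count_uniq_mem _ ut) ht -size_filter => rad1.
(* The right radical has as many elements as the left one, namely one, and contains both 0 and
   [x]. *)
have mem_rad y : (forall r : R, eps (rscale y r) = 1) ->
    y \in [seq y <- t | all (fun r => eps (rscale y r) == 1) (enum R)].
  by move=> hy; rewrite mem_filter ht andbT; apply/allP => r _; apply/eqP.
have := mem_rad 0 (fun r => etrans (congr1 eps (rscale0r M r)) eps0).
have := mem_rad x hx.
by case: (filter _ _) rad1 => [|y []] // _; rewrite !inE => /eqP-> /eqP.
Qed.

Variable eps : M -> K[i].
Hypothesis heps : generating_character eps.

(** If no character [e a] is trivial on [s], the sum of all [e a v] is 0. Summed over [a] first, it
    only retains the [v] killed by every [h i] (right nondegeneracy); there [g v = 0], so each term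
    is positive, and [v = 0] contributes: a contradiction. If [e a] is trivial, left nondegeneracy
    makes [- a] a solution. *)
Lemma hom_rscale (V : lmodType R) (s : seq V) (I : finType) (h : I -> V -> M)
    (g : V -> M) :
    uniq s -> submod_closed [in s] ->
    (forall i, linear_on [in s] (h i)) -> linear_on [in s] g ->
    {in s, forall v, (forall i, h i v = 0) -> g v = 0} ->
  exists a : {ffun I -> R},
    {in s, forall v, g v = \sum_i rscale (h i v) (a i)}.
Proof.
case: heps => epsD eps0 left_nd right_nd us [s0 sZD] hL [gD gZ] ker_hg.
have hD i := (hL i).1; have hZ i := (hL i).2.
have sD : {in s &, forall x y, x + y \in s}.
  by move=> x y sx sy; rewrite -[x]scale1r; apply: sZD.
have sZ r : {in s, forall x, r *: x \in s}.
  by move=> x sx; rewrite -[_ *: _]addr0; apply: sZD.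
pose e (a : {ffun I -> R}) v := eps (g v + \sum_i rscale (h i v) (a i)).
have [/existsP[a /allP ha]|/existsPn no_a] :=
    boolP [exists a, all (fun v => e a v == 1) s].
  exists (- a) => v sv; apply/eqP; rewrite -subr_eq0; apply/eqP.
  apply: left_nd => r; rewrite -(eqP (ha _ (sZ r v sv))) /e gZ //.
  congr eps; rewrite scalerBr; congr (_ + _).
  rewrite scaler_sumr -sumrN; apply: eq_bigr => i _.
  by rewrite ffunE rscalerN scalerN opprK hZ // scale_rscaleA.
have sum0 : \sum_a \sum_(v <- s) e a v = 0.
  rewrite big1 // => a _; have /allPn[w sw ew] := no_a a.
  apply: (sum_character_eq0 us sD _ sw ew) => x y sx sy.
  rewrite /e -epsD gD // addrACA; congr (eps (_ + _)).
  by rewrite -big_split; apply: eq_bigr => i _; rewrite hD // rscalerDl.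
pose h0 v := all (fun a : {ffun I -> R} => eps (\sum_i rscale (h i v) (a i)) == 1)
               (index_enum {ffun I -> R}).
suff : (\sum_(v <- s) #|{ffun I -> R}| * h0 v)%:R = 0 :> K[i].
  move/eqP; rewrite pnatr_eq0 (big_rem 0) //= addn_eq0 muln_eq0 -leqn0 leqNgt.
  have -> : (0 < #|{ffun I -> R}|)%N by apply/card_gt0P; exists 0.
  suff -> : h0 0 by [].
  apply/allP => a _; rewrite big1 ?eps0 // => i _.
  by rewrite -(scale0r (0 : V)) hZ // scale0r rscale0r.
rewrite -sum0 exchange_big natr_sum !big_seq; apply: eq_bigr => v sv.
have sum_h : \sum_(a : {ffun I -> R}) eps (\sum_i rscale (h i v) (a i))
    = (#|{ffun I -> R}| * h0 v)%:R.
  rewrite sum_character ?index_enum_uniq //; first by rewrite cardT enumT.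
  - by move=> a b _ _; rewrite mem_index_enum.
  move=> a b _ _; rewrite -epsD -big_split; congr eps.
  by apply: eq_bigr => i _; rewrite ffunE rscalerDr.
rewrite /e; under eq_bigr do rewrite epsD.
rewrite -mulr_sumr sum_h; have [/allP h0v|] := boolP (h0 v); last first.
  by rewrite muln0 mulr0.
suff -> : g v = 0 by rewrite eps0 mul1r.
apply: ker_hg => // i; apply: right_nd => r.
(* Testing with the family supported at [i] isolates [h i v]. *)
have /eqP <- := h0v [ffun j => if j == i then r else 0] (mem_index_enum _).
rewrite (bigD1 i) //= ffunE eqxx big1 ?addr0 // => j ne_ji.
by rewrite ffunE (negPf ne_ji) rscaler0.
Qed.

(** By [hom_rscale], [g] is [h] times some [a] and [h] is [g] times some [c]. Hence [1 - a * c] lies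
    in the right ideal [J] annihilating the values of [h], and [a] may be replaced by a unit
    congruent to it modulo [J]. *)
Lemma unit_correction (V : lmodType R) (s : seq V) (g h : V -> M) :
    uniq s -> submod_closed [in s] ->
    linear_on [in s] g -> linear_on [in s] h ->
    {in s, forall v, g v = 0 <-> h v = 0} ->
  exists u w : R,
    [/\ u * w = 1, w * u = 1 & {in s, forall v, g v = rscale (h v) u}].
Proof.
move=> us sS gL hL gh0.
have [|a ha] := @hom_rscale _ s 'I_1 (fun=> h) g us sS (fun=> hL) gL.
  by move=> v sv /(_ ord0); rewrite gh0.
have [|c hc] := @hom_rscale _ s 'I_1 (fun=> g) h us sS (fun=> gL) hL.
  by move=> v sv /(_ ord0); rewrite gh0.
pose J := [set r : R | all (fun v => rscale (h v) r == 0) s].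
have JP r : reflect {in s, forall v, rscale (h v) r = 0} (r \in J).
  by rewrite inE; apply: (iffP allP) => hr v /hr/eqP.
have [||||u [w [uw wu /JP Ju]]] := @lift_unit_mod R J _ _ _ (a ord0) (c ord0).
- by apply/JP => v _; rewrite rscaler0.
- by move=> x y /JP Jx /JP Jy; apply/JP => v sv; rewrite rscalerB Jx ?Jy ?subr0.
- by move=> x r /JP Jx; apply/JP => v sv; rewrite rscalerA Jx ?rscale0r.
- apply/JP => v sv; rewrite rscalerB rscaler1 rscalerA.
  have:= hc v sv; rewrite (ha v sv) !big_ord1 => <-.
  by rewrite subrr.
exists u, w; split=> // v sv; apply/eqP.
by rewrite ha // big_ord1 eq_sym -subr_eq0 -rscalerB Ju.
Qed.

End GeneratingCharacter.

Lemma wtRT_leP (V : nmodType) (n : nat) (v : V ^ n) (k : nat) :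
  reflect (forall i : 'I_n, (k <= i)%N -> v i = 0) (wtRT v <= k)%N.
Proof.
apply: (iffP (bigop.bigmax_leqP _ _ _)) => h i.
  by move=> ki; apply/eqP; apply: contraLR ki => /h; rewrite -ltnNge.
by rewrite ltnNge; apply: contra => /h ->.
Qed.

Lemma ffun_enum (I : finType) (T : choiceType) (t : seq T) :
    (forall x, x \in t) ->
  exists2 s : seq {ffun I -> T}, uniq s & forall v, v \in s.
Proof.
move=> ht.
pose s := [seq [ffun i => val (g i)] | g : {ffun I -> seq_sub t} <- enum {ffun I -> seq_sub t}].
exists (undup s) => [|v]; first exact: undup_uniq.
rewrite mem_undup; apply/mapP; exists [ffun i => SeqSub (ht (v i))].
  by rewrite mem_enum.
by apply/ffunP => i; rewrite !ffunE.
Qed.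

(** * Invertible triangular matrices as RT-isometries *)

Section Triangular.
Variables (R : finPzRingType) (n : nat) (A : 'M[R]_n).
Hypotheses (A_trig : is_trig_mx A)
  (A_diag : forall i, exists w, A i i * w = 1 /\ w * A i i = 1).

(** Forward substitution shows that left multiplication by [A] is injective, hence bijective on the
    finite set of matrices. *)
Lemma trig_in_GL : in_GL A.
Proof.
have A_reg (X : 'M[R]_n) : A *m X = 0 -> X = 0.
  move=> AX0; apply/matrixP => i k; rewrite mxE.
  have [m] := ubnP i; elim: m i => // m IHm i /ltnSE le_im.
  have [w [_ wK]] := A_diag i; rewrite -[X i k]mul1r -wK -mulrA.
  have := congr1 (fun Y : 'M_n => Y i k) AX0; rewrite !mxE (bigD1 i) //=.
  rewrite big1 ?addr0 => [->|j ne_ji]; first by rewrite mulr0.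
  have [lt_ij|lt_ji|/val_inj eq_ij] := ltngtP i j.
  - by rewrite (is_trig_mxP A_trig) ?mul0r.
  - by rewrite IHm ?mulr0 // (leq_trans lt_ji).
  - by rewrite eq_ij eqxx in ne_ji.
have A_inj : injective (mulmx A : 'M_n -> 'M_n).
  by move=> X Y /eqP; rewrite -subr_eq0 -mulmxBr => /eqP/A_reg/eqP; rewrite subr_eq0 => /eqP.
have [B _ BK] := injF_bij A_inj.
exists (B 1%:M); split; first exact: BK.
by apply: A_inj; rewrite mulmxA BK mul1mx mulmx1.
Qed.

Variable M : bimodType R.

Lemma row_mulmx_trig (v : M ^ n) (j : 'I_n) :
    (forall i : 'I_n, (j < i)%N -> v i = 0) ->
  row_mulmx v A j = rscale (v j) (A j j).
Proof.
move=> hv; rewrite ffunE (bigD1 j) //= big1 ?addr0 // => i ne_ij.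
have [lt_ij|/hv->|/val_inj eq_ij] := ltngtP i j; last by rewrite eq_ij eqxx in ne_ij.
  by rewrite (is_trig_mxP A_trig) // rscaler0.
by rewrite rscale0r.
Qed.

Lemma row_mulmx_wtRT (v : M ^ n) : wtRT (row_mulmx v A) = wtRT v.
Proof.
have le_wt k : (wtRT (row_mulmx v A) <= k)%N = (wtRT v <= k)%N.
  apply/wtRT_leP/wtRT_leP => hv i ki; last first.
    rewrite row_mulmx_trig ?hv ?rscale0r // => l /ltnW il.
    exact/hv/(leq_trans ki).
  (* Descending induction on [i]: once the later entries of [v] vanish, entry [i] of the product is
     [v i] times a unit. *)
  have [m] := ubnP (n - i); elim: m => // m IHm in i ki * => /ltnSE le_m.
  have := hv i ki; rewrite row_mulmx_trig => [|l il].
    have [w [wK _]] := A_diag i => vA0.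
    by rewrite -[v i]rscaler1 -wK rscalerA vA0 rscale0r.
  apply: IHm (ltnW (leq_ltn_trans ki il)) (leq_trans _ le_m).
  exact: ltn_sub2l (ltn_ord i) il.
by apply/eqP; rewrite eqn_leq -le_wt leqnn le_wt leqnn.
Qed.

Lemma row_mulmx_RT_isometry :
  RT_isometry predT (fun v : M ^ n => row_mulmx v A).
Proof.
have rD (v w : M ^ n) : row_mulmx (v + w) A = row_mulmx v A + row_mulmx w A.
  apply/ffunP => j; rewrite !ffunE -big_split; apply: eq_bigr => i _.
  by rewrite ffunE rscalerDl.
have rZ r (v : M ^ n) : row_mulmx (r *: v) A = r *: row_mulmx v A.
  apply/ffunP => j; rewrite !ffunE scaler_sumr; apply: eq_bigr => i _.
  by rewrite ffunE scale_rscaleA.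
split=> [v w _ _|r v _|v w _ _ eq_vw|v _] //; last exact: row_mulmx_wtRT.
apply/eqP; rewrite -subr_eq0; apply/eqP/ffunP => i; rewrite [RHS]ffunE.
(* Injectivity follows from the weight: [v - w] has the same weight as its zero image. *)
apply: (wtRT_leP _ 0%N) => //; rewrite -row_mulmx_wtRT rD -scaleN1r rZ eq_vw.
by rewrite scaleN1r subrr; apply/wtRT_leP => l _; rewrite ffunE.
Qed.

End Triangular.

(** * Construction of one column of the matrix *)

Section Column.
Variables (K : realType) (R : finPzRingType) (M : bimodType R).
Hypothesis (hM : Frobenius_bimodule K M).
Variables (n : nat) (C : {pred M ^ n}) (f : M ^ n -> M ^ n).
Hypotheses (hC : submod_closed C) (hf : RT_isometry C f).

Lemma RT_isometry_column (j : 'I_n) : exists a : {ffun 'I_n -> R},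
  [/\ forall i : 'I_n, (i < j)%N -> a i = 0,
      exists w, a j * w = 1 /\ w * a j = 1 &
      {in C, forall v, f v j = \sum_i rscale (v i) (a i)}].
Proof.
have [eps heps] := Frobenius_generating_character hM.
have [t _ ht] := Frobenius_bimodule_enum hM.
have [sM usM hsM] := @ffun_enum 'I_n _ t ht.
pose above (v : M ^ n) := [forall i : 'I_n, (j < i)%N ==> (v i == 0)].
have aboveP (v : M ^ n) : reflect (forall i : 'I_n, (j < i)%N -> v i = 0) (above v).
  by apply: (iffP 'forall_implyP) => h i /h/eqP.
pose s := [seq v <- sM | v \in C]; pose sj := [seq v <- s | above v].
have sE (v : M ^ n) : (v \in s) = (v \in C) by rewrite mem_filter hsM andbT.
have sjE (v : M ^ n) : (v \in sj) = above v && (v \in C) by rewrite mem_filter sE.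
have us : uniq s by rewrite filter_uniq.
have usj : uniq sj by rewrite filter_uniq.
have [C0 CZD] := hC.
have sS : submod_closed [in s].
  by split=> [|r v w]; rewrite ?inE /= ?inE !sE //; exact: CZD.
have sjS : submod_closed [in sj].
  split=> [|r v w]; rewrite ?inE /= ?inE !sjE.
    by rewrite C0 andbT; apply/aboveP => i _; rewrite ffunE.
  move=> /andP[/aboveP v0 Cv] /andP[/aboveP w0 Cw]; rewrite CZD // andbT.
  by apply/aboveP => i ji; rewrite !ffunE v0 // w0 // scaler0 addr0.
have linf : linear_on [in s] (fun v => f v j).
  by split=> [v w|r v]; rewrite ?inE /= ?inE !sE => *;
    rewrite ?(RT_isometryD hf) ?(RT_isometryZ hf) // ffunE.
have lini i : linear_on [in s] (fun v : M ^ n => v i).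
  by split=> [v w|r v] *; rewrite ffunE.
have subL (g : M ^ n -> M) : linear_on [in s] g -> linear_on [in sj] g.
  case=> gD gZ; split=> [v w|r v]; rewrite ?inE /= ?inE !sjE.
    by move=> /andP[_ Cv] /andP[_ Cw]; rewrite gD // ?inE /= ?sE.
  by move=> /andP[_ Cv]; rewrite gZ // ?inE /= ?sE.
have [v|u [w [uw wu hu]]] := unit_correction heps usj sjS (subL _ linf) (subL _ (lini j)).
  rewrite sjE => /andP[/aboveP v0 Cv].
  (* With 0-based indices, entry [j] is the last one allowed by weight [j.+1], so its vanishing is a
     condition on the weight, which [f] preserves. *)
  have wt_le (x : M ^ n) : (wtRT x <= j.+1)%N ->
      x j = 0 <-> (wtRT x <= j)%N.
    move/wtRT_leP => x0; split=> [xj|/wtRT_leP]; last exact.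
    apply/wtRT_leP => i; rewrite leq_eqVlt => /orP[/eqP/val_inj<- //|].
    exact: x0.
  have wtv : (wtRT v <= j.+1)%N by apply/wtRT_leP.
  by rewrite !wt_le ?(RT_isometry_wt hf).
(* Cutting off the indices up to [j] makes the common kernel of the [h i] on [s] equal to [sj],
   where [g] vanishes; the coefficients [b i] with [i] at most [j] then multiply 0 and can be
   overwritten. *)
pose h (i : 'I_n) (v : M ^ n) := if (j < i)%N then v i else 0.
pose g (v : M ^ n) := f v j - rscale (v j) u.
have linh i : linear_on [in s] (h i).
  by rewrite /h; split=> [v x|r v] *; case: ifP; rewrite ?ffunE ?addr0 ?scaler0.
have ling : linear_on [in s] g.
  rewrite /g; split=> [v x sv sx|r v sv].
    by rewrite linf.1 // ffunE rscalerDl opprD addrACA.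
  by rewrite linf.2 // ffunE scale_rscaleA scalerBr.
have [v sv hv|b hb] := hom_rscale heps us sS linh ling.
  rewrite /g hu ?subrr // sjE -sE sv andbT; apply/aboveP => i ji.
  by have := hv i; rewrite /h ji.
exists [ffun i : 'I_n => if (j < i)%N then b i else if i == j then u else 0].
split=> [i ij||v Cv]; last 1 first.
- have := hb v; rewrite sE => /(_ Cv)/eqP; rewrite subr_eq => /eqP->.
  rewrite [RHS](bigD1 j) //= (bigD1 j) //= /h ffunE ltnn eqxx rscale0r add0r addrC.
  congr (_ + _); apply: eq_bigr => i ne_ij; rewrite ffunE (negPf ne_ij).
  by case: ifP => _; rewrite ?rscale0r ?rscaler0.
- by rewrite ffunE ltnNge ltnW //= -val_eqE /= ltn_eqF.
- by exists w; rewrite !ffunE ltnn eqxx.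
Qed.

End Column.

Theorem theorem4p13 (K : realType) (R : finPzRingType) (M : bimodType R)
    (hM : Frobenius_bimodule K M) (n : nat)
    (C : {pred M ^ n}) (hC : submod_closed C)
    (f : M ^ n -> M ^ n) (hf : RT_isometry C f) :
  exists A : 'M[R]_n,
    [/\ in_LT A,
        {in C, forall v, f v = row_mulmx v A} &
        RT_isometry predT (fun v : M ^ n => row_mulmx v A)].
Proof.
have [a ha] := fin_all_exists (RT_isometry_column hM hC hf).
pose A : 'M[R]_n := \matrix_(i, j) a j i.
have A_trig : is_trig_mx A.
  by apply/is_trig_mxP => i j ij; rewrite mxE; have [a0 _ _] := ha j; exact: a0.
have A_diag i : exists w, A i i * w = 1 /\ w * A i i = 1.
  by rewrite mxE; have [] := ha i.
exists A; split.
- by split; [exact: A_trig | exact: trig_in_GL].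
- move=> v Cv; apply/ffunP => j; have [_ _ ->//] := ha j; rewrite ffunE.
  by apply: eq_bigr => i _; rewrite mxE.
- exact: row_mulmx_RT_isometry.
Qed.
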